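(* Let $\mu$ be an $n$-dimensional complex associative algebra on $\mathbb C^n$. Then the functional $F_n:\mathcal A_n\to\mathbb R$ attains its minimum value (over $\mathcal A_n$) at some point $[\lambda]\in\mathrm{GL}(n).[\mu]$ if and only if $\mu$ is semisimple. In this case $F_n([\lambda])=\frac4n$.
   Context: $V_n$ is the space of bilinear maps $\mu:\mathbb C^n\times\mathbb C^n\to\mathbb C^n$ with $\mathrm{GL}(n)$-action $g.\mu(X,Y)=g\mu(g^{-1}X,g^{-1}Y)$ and standard Hermitian structures. $\mathcal A_n\subset\mathbb PV_n$ is the projectivization of the algebraic set of associative $\mu\in V_n$. $L^\mu_XY=\mu(X,Y)$, $R^\mu_XY=\mu(Y,X)$, $\mathrm M_\mu=2\sum_i L^\mu_{X_i}(L^\mu_{X_i})^*-2\sum_i (L^\mu_{X_i})^*L^\mu_{X_i}-2\sum_i (R^\mu_{X_i})^*R^\mu_{X_i}$ ($\{X_i\}$ orthonormal), $\|\mu\|^2=\sum_{i,j}\|\mu(X_i,X_j)\|^2$, $F_n([\mu])=\operatorname{tr}\mathrm M_\mu^2/\|\mu\|^4$. An associative algebra is semisimple if its radical (largest nilpotent ideal) is zero. *)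

(* Defs.v *)
From HB Require Import structures.
From mathcomp Require Import all_boot all_order all_algebra.
From mathcomp Require Import reals.
From mathcomp Require Import complex.
Set Implicit Arguments. Unset Strict Implicit. Unset Printing Implicit Defensive.
Import Order.TTheory GRing.Theory Num.Theory.
Local Open Scope ring_scope.

Section Defs.
Variable R : realType.
Local Notation C := R[i].

Definition ebasis (n : nat) (i : 'I_n) : 'cV[C]_n := delta_mx i 0.

(* V_n: a bilinear map C^n x C^n -> C^n, given by its values mu(e_i, e_j)
   on pairs of standard basis vectors. *)
Definition bilin (n : nat) := 'I_n -> 'I_n -> 'cV[C]_n.

Definition bapp n (mu : bilin n) (X Y : 'cV[C]_n) : 'cV[C]_n :=
  \sum_(i < n) \sum_(j < n) (X i 0 * Y j 0) *: mu i j.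

Definition assoc n (mu : bilin n) : Prop :=
  forall X Y Z : 'cV[C]_n, bapp mu (bapp mu X Y) Z = bapp mu X (bapp mu Y Z).

Definition gact n (g : 'M[C]_n) (mu : bilin n) : bilin n :=
  fun i j => g *m bapp mu (invmx g *m ebasis i) (invmx g *m ebasis j).

Definition adjmx n (A : 'M[C]_n) : 'M[C]_n := (map_mx Num.conj A)^T.

Definition Lmx n (mu : bilin n) (X : 'cV[C]_n) : 'M[C]_n :=
  \matrix_(k, j) (bapp mu X (ebasis j)) k 0.
Definition Rmx n (mu : bilin n) (X : 'cV[C]_n) : 'M[C]_n :=
  \matrix_(k, j) (bapp mu (ebasis j) X) k 0.

Definition Mmu n (mu : bilin n) : 'M[C]_n :=
  2%:R *: (\sum_(i < n) Lmx mu (ebasis i) *m adjmx (Lmx mu (ebasis i)))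
  - 2%:R *: (\sum_(i < n) adjmx (Lmx mu (ebasis i)) *m Lmx mu (ebasis i))
  - 2%:R *: (\sum_(i < n) adjmx (Rmx mu (ebasis i)) *m Rmx mu (ebasis i)).

Definition normsq n (mu : bilin n) : R :=
  \sum_(i < n) \sum_(j < n) \sum_(k < n)
     ((complex.Re (mu i j k 0)) ^+ 2 + (complex.Im (mu i j k 0)) ^+ 2).

(* F_n([mu]) = tr M_mu^2 / ||mu||^4  (tr M_mu^2 is real since M_mu is
   Hermitian; we take its real part to land in R) *)
Definition Fn n (mu : bilin n) : R :=
  complex.Re (\tr (Mmu mu *m Mmu mu)) / (normsq mu) ^+ 2.

Definition is_min_point n (lam : bilin n) : Prop :=
  lam <> (fun _ _ => 0) /\ assoc lam /\
  forall nu : bilin n, nu <> (fun _ _ => 0) -> assoc nu -> Fn lam <= Fn nu.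

Definition is_ideal n (mu : bilin n) (I : 'cV[C]_n -> Prop) : Prop :=
  I 0 /\ (forall x y, I x -> I y -> I (x + y)) /\
  (forall (a : C) x, I x -> I (a *: x)) /\
  (forall x y, I x -> I (bapp mu x y) /\ I (bapp mu y x)).

Definition is_nilpotent n (mu : bilin n) (I : 'cV[C]_n -> Prop) : Prop :=
  exists k : nat, forall (x : 'cV[C]_n) (s : seq 'cV[C]_n),
    I x -> (forall y, y \in s -> I y) -> size s = k ->
    foldl (bapp mu) x s = 0.

(* semisimple: the radical (largest nilpotent ideal) is zero, i.e. every
   nilpotent two-sided ideal is zero *)
Definition semisimple n (mu : bilin n) : Prop :=
  forall I, is_ideal mu I -> is_nilpotent mu I -> forall x, I x -> x = 0.

End Defs.

(* Main.v *)
Require Import Defs.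
From HB Require Import structures.
From mathcomp Require Import all_boot all_order all_algebra.
From mathcomp Require Import reals boolp.
From mathcomp Require Import complex.
From mathcomp Require Import ring.
Import Order.TTheory GRing.Theory Num.Theory.
Set Implicit Arguments. Unset Strict Implicit. Unset Printing Implicit Defensive.
Local Open Scope ring_scope.

(** Since M is Hermitian with trace -2|mu|^2, Cauchy-Schwarz gives F >= 4/n, with
    equality exactly when M is scalar; the algebra C^n attains 4/n.

    If M = c I, then c < 0. For an ideal N with N^2 = 0 and orthogonal projection
    P, the trace of M P is a sum of squares, while it equals c dim N; so N = 0,
    and an algebra without square-zero ideals is semisimple.

    Conversely, a semisimple algebra has a basis of matrix units u_k v_l, where
    the v_k u_k are primitive idempotents obtained from minimal right ideals. In
    the Hermitian structure in which suitably rescaled matrix units are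
    orthonormal, M = -2 I. *)

(** * Hermitian projections and the Hilbert-Schmidt norm *)

Section Projector.
Variables (C : numClosedFieldType).
Local Notation "A ^H" := ((map_mx Num.conj A)^T) (at level 8, format "A ^H").

Lemma adjM p q r (A : 'M[C]_(p, q)) (B : 'M_(q, r)) : (A *m B)^H = B^H *m A^H.
Proof. by rewrite map_mxM trmx_mul. Qed.
Lemma adjB p q (A B : 'M[C]_(p, q)) : (A - B)^H = A^H - B^H.
Proof. by rewrite map_mxB linearB. Qed.
Lemma adjD p q (A B : 'M[C]_(p, q)) : (A + B)^H = A^H + B^H.
Proof. by rewrite map_mxD linearD. Qed.
Lemma adj1 p : (1%:M : 'M[C]_p)^H = 1%:M.
Proof. by rewrite map_scalar_mx tr_scalar_mx rmorph1. Qed.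
Lemma adjK p q (A : 'M[C]_(p, q)) : A^H^H = A.
Proof. by apply/matrixP => i j; rewrite !mxE conjCK. Qed.

(** Squared Hilbert-Schmidt norm, kept in [C], whose order makes a nonnegative element real. *)
Definition hsq p q (A : 'M[C]_(p, q)) : C := \tr (A *m A^H).

Lemma hsqE p q (A : 'M[C]_(p, q)) : hsq A = \sum_i \sum_j `|A i j| ^+ 2.
Proof.
apply: eq_bigr => i _; rewrite mxE; apply: eq_bigr => j _.
by rewrite !mxE normCK.
Qed.

Lemma hsq_ge0 p q (A : 'M[C]_(p, q)) : 0 <= hsq A.
Proof. by rewrite hsqE; do 2![apply: sumr_ge0 => ? _]; rewrite exprn_ge0. Qed.

Lemma hsq_eq0 p q (A : 'M[C]_(p, q)) : hsq A = 0 -> A = 0.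
Proof.
rewrite hsqE => /eqP h; apply/matrixP => i j; move: h; rewrite mxE.
rewrite psumr_eq0 => [/allP/(_ i (mem_index_enum i))/=|? _]; last first.
  by apply: sumr_ge0 => ? _; rewrite exprn_ge0.
rewrite psumr_eq0 => [/allP/(_ j (mem_index_enum j))/=|? _]; last first.
  by rewrite exprn_ge0.
by rewrite sqrf_eq0 normr_eq0 => /eqP.
Qed.

Definition hproj n (P : 'M[C]_n) := P *m P = P /\ P^H = P.

Lemma hprojC n (P : 'M[C]_n) : hproj P -> hproj (1%:M - P).
Proof.
move=> [PP PH]; split; last by rewrite adjB adj1 PH.
by rewrite mulmxBl !mulmxBr !mul1mx mulmx1 PP subrr subr0.
Qed.

Lemma hproj_hsq n (P : 'M[C]_n) : hproj P -> hsq P = \tr P.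
Proof. by move=> [PP PH]; rewrite /hsq PH PP. Qed.

Lemma hsq_mulr_proj n p (P : 'M[C]_n) (A : 'M_(p, n)) :
  hproj P -> hsq (A *m P) = \tr (A^H *m A *m P).
Proof.
move=> [PP PH]; rewrite /hsq adjM PH mulmxA -(mulmxA A P P) PP.
by rewrite mxtrace_mulC mulmxA.
Qed.

Lemma hsq_mull_proj n p (P : 'M[C]_n) (A : 'M_(n, p)) :
  hproj P -> hsq (P *m A) = \tr (A *m A^H *m P).
Proof.
move=> [PP PH]; rewrite /hsq adjM PH -!mulmxA mxtrace_mulC.
by rewrite -!mulmxA PP.
Qed.

(** Pythagoras for the splitting of the source by [P] and its complement. *)
Lemma hsq_split n p (P : 'M[C]_n) (A : 'M_(p, n)) : hproj P ->
  hsq A = hsq (A *m P) + hsq (A *m (1%:M - P)).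
Proof.
move=> hP; rewrite !hsq_mulr_proj //; last exact: hprojC.
by rewrite mulmxBr mulmx1 raddfB /= addrC subrK mxtrace_mulC.
Qed.

(** Orthogonal projection onto a subspace given only as a predicate. By induction on [k], either it
    exists or some projection with range in [S] has trace [k]; a vector of [S] that it does not fix
    yields one more dimension. The trace cannot reach [n.+1]. *)
Lemma hproj_exists n (S : 'cV[C]_n -> Prop) :
  S 0 -> (forall x y, S x -> S y -> S (x + y)) -> (forall a x, S x -> S (a *: x)) ->
  exists P : 'M_n, [/\ hproj P, forall x, S (P *m x) & forall x, S x -> P *m x = x].
Proof.
move=> S0 SD SZ.
have /(_ n.+1)[//|[P [hP _ trP]]] : forall k, (exists P : 'M_n,
      [/\ hproj P, forall x, S (P *m x) & forall x, S x -> P *m x = x]) \/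
    (exists P : 'M_n, [/\ hproj P, forall x, S (P *m x) & \tr P = k%:R]).
  elim=> [|k [|[P [hP SP trP]]]]; [right|by left|].
    exists 0; split; rewrite ?mxtrace0 //; last by move=> x; rewrite mul0mx.
    by split; rewrite ?mul0mx // map_mx0 trmx0.
  have [PS|] := pselect (forall x, S x -> P *m x = x); first by left; exists P.
  move=> /existsNP[x] /not_implyP[Sx Px]; right.
  pose y := x - P *m x.
  have Sy : S y by apply: SD => //; rewrite -scaleN1r; apply: SZ.
  have [PP PH] := hP.
  have Py : P *m y = 0 by rewrite /y mulmxBr mulmxA PP subrr.
  have yP : y^H *m P = 0 by rewrite -PH -adjM Py map_mx0 trmx0.
  pose d := hsq y.
  have d0 : d != 0.
    by apply/eqP => /hsq_eq0/eqP; rewrite subr_eq0 eq_sym => /eqP.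
  have yy : y^H *m y = d%:M by rewrite [LHS]mx11_scalar /d /hsq mxtrace_mulC trace_mx11.
  have dr : d^* = d by apply/CrealP; rewrite ger0_real ?hsq_ge0.
  (* Gram-Schmidt: [y] is orthogonal to the range of [P], so adding the projection onto its line
     raises the trace by 1. *)
  exists (P + d^-1 *: (y *m y^H)); split.
  - split.
      rewrite mulmxDl !mulmxDr PP -!scalemxAl -!scalemxAr.
      rewrite mulmxA Py mul0mx -mulmxA yP mulmx0 !scaler0 addr0 add0r.
      congr (_ + _ *: _).
      by rewrite -mulmxA (mulmxA y^H) yy mul_scalar_mx -scalemxAr scalerA mulVf // scale1r.
    rewrite adjD PH map_mxZ linearZ /= adjM adjK; congr (_ + _ *: _).
    by rewrite fmorphV /= dr.
  - move=> z; rewrite mulmxDl; apply: SD => //.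
    rewrite -scalemxAl -mulmxA; apply: (SZ).
    by rewrite [y^H *m z]mx11_scalar mul_mx_scalar; apply: SZ.
  - rewrite mxtraceD mxtraceZ trP -[\tr (y *m _)]/d mulVf // -natr1.
    by [].
have := hsq_ge0 (1%:M - P); rewrite hproj_hsq; last exact: hprojC.
by rewrite raddfB /= trP mxtrace1 subr_ge0 ler_nat ltnn.
Qed.

(* Applied with L i and S i the left and right multiplications by e_i and T j the
   right multiplication by Q e_j, where Q = 1 - P: the trace is then twice the sum
   of the |P mu(Q e_i, Q e_j)|^2. *)
Lemma moment_trace_ge0 n (P : 'M[C]_n) (L S T : 'I_n -> 'M[C]_n) :
  hproj P -> (forall i, P *m L i *m P = L i *m P) ->
  (forall i, P *m T i *m P = S i *m P) ->
  (forall i j k, (P *m L i *m (1%:M - P)) k j = (P *m T j) k i) ->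
  0 <= \tr ((2%:R *: (\sum_i L i *m (L i)^H) - 2%:R *: (\sum_i (L i)^H *m L i)
             - 2%:R *: (\sum_i (S i)^H *m S i)) *m P).
Proof.
move=> hP PLP PTP PLT.
have swap : \sum_i hsq (P *m L i *m (1%:M - P)) = \sum_j hsq (P *m T j).
  under eq_bigr do rewrite hsqE exchange_big.
  under [RHS]eq_bigr do rewrite hsqE exchange_big.
  rewrite exchange_big; apply: eq_bigr => j _; apply: eq_bigr => i _.
  by apply: eq_bigr => k _; rewrite PLT.
(* The positive term splits into the two negative ones plus a remainder: cut [P L_i] by [P] and its
   complement, turn the second piece into the [P T_j] by [swap], and cut these again. *)
have tr1 : \sum_i \tr (L i *m (L i)^H *m P) = \sum_i hsq (L i *m P) +
    (\sum_i hsq (S i *m P) + \sum_j hsq (P *m T j *m (1%:M - P))).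
  transitivity (\sum_i (hsq (L i *m P) + hsq (P *m L i *m (1%:M - P)))).
    by apply: eq_bigr => i _; rewrite -PLP -hsq_split // hsq_mull_proj.
  rewrite big_split swap; congr (_ + _); rewrite -big_split.
  by apply: eq_bigr => j _ /=; rewrite -PTP -hsq_split.
have tr2 (A : 'I_n -> 'M[C]_n) :
    \sum_i \tr ((A i)^H *m A i *m P) = \sum_i hsq (A i *m P).
  by apply: eq_bigr => i _; rewrite hsq_mulr_proj.
rewrite !mulmxBl -!scalemxAl !mulmx_suml.
rewrite !(raddfB (@mxtrace C n)) /= !mxtraceZ !(raddf_sum (@mxtrace C n)) /=.
rewrite tr1 !tr2 !mulrDr [2 * _ + _]addrC addrK addrC addKr.
by rewrite mulr_ge0 // sumr_ge0 // => i _; apply: hsq_ge0.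
Qed.

End Projector.

(** * Bilinear maps, their moment matrix and the bound 4/n *)

Section Bilinear.
Variables (R : realType) (n : nat).
Local Notation C := R[i].
Local Notation vec := 'cV[C]_n.
Implicit Types (mu : bilin R n) (X Y Z : vec) (g : 'M[C]_n).

Lemma bapp_is_linear mu X : linear (bapp mu X).
Proof.
move=> a Y Z; rewrite /bapp scaler_sumr -big_split; apply: eq_bigr => i _ /=.
rewrite scaler_sumr -big_split; apply: eq_bigr => j _ /=.
by rewrite !mxE mulrDr scalerDl scalerA mulrCA.
Qed.
HB.instance Definition _ mu X :=
  GRing.isLinear.Build C vec vec *:%R (bapp mu X) (bapp_is_linear mu X).

(** The product with its left factor as last argument, so that linearity in that factor can be
    registered as an instance. *)
Definition rapp mu Y X := bapp mu X Y.
Lemma rapp_is_linear mu Y : linear (rapp mu Y).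
Proof.
move=> a X Z; rewrite /rapp /bapp scaler_sumr -big_split; apply: eq_bigr => i _ /=.
rewrite scaler_sumr -big_split; apply: eq_bigr => j _ /=.
by rewrite !mxE mulrDl scalerDl scalerA mulrA.
Qed.
HB.instance Definition _ mu Y :=
  GRing.isLinear.Build C vec vec *:%R (rapp mu Y) (rapp_is_linear mu Y).

Lemma bappDl mu X Y Z : bapp mu (X + Y) Z = bapp mu X Z + bapp mu Y Z.
Proof. exact: (raddfD (rapp mu Z)). Qed.
Lemma bappDr mu X Y Z : bapp mu X (Y + Z) = bapp mu X Y + bapp mu X Z.
Proof. exact: raddfD. Qed.
Lemma bappBr mu X Y Z : bapp mu X (Y - Z) = bapp mu X Y - bapp mu X Z.
Proof. exact: raddfB. Qed.
Lemma bapp0l mu Z : bapp mu 0 Z = 0.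
Proof. exact: (raddf0 (rapp mu Z)). Qed.
Lemma bapp0r mu Z : bapp mu Z 0 = 0.
Proof. exact: raddf0. Qed.
Lemma bappZl mu a X Z : bapp mu (a *: X) Z = a *: bapp mu X Z.
Proof. exact: (linearZ_LR (rapp mu Z)). Qed.
Lemma bappZr mu a X Z : bapp mu X (a *: Z) = a *: bapp mu X Z.
Proof. exact: linearZ_LR. Qed.
Lemma bapp_suml mu (I : Type) (r : seq I) (P : pred I) (F : I -> vec) Z :
  bapp mu (\sum_(i <- r | P i) F i) Z = \sum_(i <- r | P i) bapp mu (F i) Z.
Proof. exact: (raddf_sum (rapp mu Z)). Qed.
Lemma bapp_sumr mu (I : Type) (r : seq I) (P : pred I) (F : I -> vec) Z :
  bapp mu Z (\sum_(i <- r | P i) F i) = \sum_(i <- r | P i) bapp mu Z (F i).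
Proof. exact: raddf_sum. Qed.

Lemma cV_ebasis X : X = \sum_i X i 0 *: ebasis R i.
Proof.
by rewrite {1}[X]matrix_sum_delta; apply: eq_bigr => i _; rewrite big_ord1.
Qed.

Lemma bapp_ebasis mu i j : bapp mu (ebasis R i) (ebasis R j) = mu i j.
Proof.
rewrite /bapp (bigD1 i) //= (bigD1 j) //= !mxE !eqxx mulr1 scale1r.
rewrite big1 => [|k /negPf kj]; last by rewrite !mxE kj mulr0 scale0r.
rewrite big1 ?addr0 // => k /negPf ki; apply: big1 => l _.
by rewrite !mxE ki mul0r scale0r.
Qed.

Lemma gactE g mu X Y :
  bapp (gact g mu) X Y = g *m bapp mu (invmx g *m X) (invmx g *m Y).
Proof.
have dec Z : invmx g *m Z = \sum_i Z i 0 *: (invmx g *m ebasis R i).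
  by rewrite {1}[Z]cV_ebasis mulmx_sumr; apply: eq_bigr => i _; rewrite scalemxAr.
rewrite (dec X) (dec Y) bapp_suml mulmx_sumr {1}/bapp.
apply: eq_bigr => i _; rewrite bapp_sumr mulmx_sumr.
by apply: eq_bigr => j _; rewrite bappZl bappZr -!scalemxAr scalerA.
Qed.

Lemma gact_assoc g mu : g \in unitmx -> assoc mu -> assoc (gact g mu).
Proof. by move=> gu mA X Y Z; rewrite !gactE !mulKmx // mA. Qed.

Lemma adjmxE (A : 'M[C]_n) i j : adjmx A i j = (A j i)^*%R.
Proof. by rewrite !mxE. Qed.

Lemma Lmx_ebasis mu i k j : Lmx mu (ebasis R i) k j = mu i j k 0.
Proof. by rewrite mxE bapp_ebasis. Qed.
Lemma Rmx_ebasis mu i k j : Rmx mu (ebasis R i) k j = mu j i k 0.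
Proof. by rewrite mxE bapp_ebasis. Qed.

Lemma MmuE mu a b : Mmu mu a b =
  2 * \sum_i \sum_j mu i j a 0 * (mu i j b 0)^*%R
  - 2 * \sum_i \sum_k (mu i a k 0)^*%R * mu i b k 0
  - 2 * \sum_i \sum_k (mu a i k 0)^*%R * mu b i k 0.
Proof.
rewrite !mxE !summxE; congr (_ - _ - _); congr (_ * _); apply: eq_bigr => i _;
  rewrite !mxE; apply: eq_bigr => j _;
  by rewrite adjmxE ?Lmx_ebasis ?Rmx_ebasis.
Qed.

Lemma Mmu_adj mu : adjmx (Mmu mu) = Mmu mu.
Proof.
apply/matrixP => a b; rewrite adjmxE !MmuE !rmorphB !rmorphM !rmorph_sum /=.
rewrite !conjC_nat; congr (_ - _ - _); congr (_ * _); apply: eq_bigr => i _;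
  rewrite rmorph_sum; apply: eq_bigr => j _;
  by rewrite rmorphM /= conjCK mulrC.
Qed.

Lemma normsqE mu : (normsq mu)%:C%C = \sum_i \sum_j \sum_k `|mu i j k 0| ^+ 2.
Proof.
rewrite /normsq rmorph_sum; apply: eq_bigr => i _; rewrite rmorph_sum.
apply: eq_bigr => j _; rewrite rmorph_sum; apply: eq_bigr => k _.
exact: add_Re2_Im2.
Qed.

Lemma normsq_ge0 mu : 0 <= normsq mu.
Proof.
by do 3![apply: sumr_ge0 => ? _]; rewrite addr_ge0 ?sqr_ge0.
Qed.

Lemma normsq_gt0 mu : mu <> (fun _ _ => 0) -> 0 < normsq mu.
Proof.
move=> mu0; rewrite lt_def normsq_ge0 andbT; apply/eqP => nm0; case: mu0.
apply/funext => i; apply/funext => j; apply/colP => k; rewrite mxE.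
move: (normsqE mu); rewrite nm0 /= => /esym/eqP.
rewrite psumr_eq0 => [/allP/(_ i (mem_index_enum i))/=|? _]; last first.
  by do 2![apply: sumr_ge0 => ? _]; rewrite exprn_ge0.
rewrite psumr_eq0 => [/allP/(_ j (mem_index_enum j))/=|? _]; last first.
  by do 1![apply: sumr_ge0 => ? _]; rewrite exprn_ge0.
rewrite psumr_eq0 => [/allP/(_ k (mem_index_enum k))/=|? _]; last first.
  by rewrite exprn_ge0.
by rewrite sqrf_eq0 normr_eq0 => /eqP.
Qed.

(** Each of the three sums in M has trace |mu|^2, and 2 - 2 - 2 = -2. *)
Lemma mxtrace_Mmu mu : \tr (Mmu mu) = (- 2 * normsq mu)%:C%C.
Proof.
rewrite rmorphM rmorphN rmorph_nat /= normsqE /mxtrace.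
under eq_bigr do rewrite MmuE.
rewrite !sumrB -!mulr_sumr [X in X - _ - _](_ : _ =
    2 * \sum_i \sum_j \sum_k `|mu i j k 0| ^+ 2); last first.
  congr (_ * _); rewrite exchange_big; apply: eq_bigr => i _.
  rewrite exchange_big; apply: eq_bigr => j _.
  by apply: eq_bigr => k _; rewrite normCK.
rewrite [X in _ - X - _](_ : _ =
    2 * \sum_i \sum_j \sum_k `|mu i j k 0| ^+ 2); last first.
  congr (_ * _); rewrite exchange_big; apply: eq_bigr => i _.
  by apply: eq_bigr => j _; apply: eq_bigr => k _; rewrite mulrC normCK.
rewrite [X in _ - X](_ : _ =
    2 * \sum_i \sum_j \sum_k `|mu i j k 0| ^+ 2); last first.
  congr (_ * _); apply: eq_bigr => i _.
  by apply: eq_bigr => j _; apply: eq_bigr => k _; rewrite mulrC normCK.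
by rewrite subrr sub0r mulNr.
Qed.

Lemma herm_tr_sq (H : 'M[C]_n) : adjmx H = H -> \tr (H *m H) = hsq H.
Proof. by move=> HH; rewrite -{2}HH. Qed.

(** The trace-free part of the moment matrix, for n > 0. *)
Definition Mmu0 mu := Mmu mu - ((- 2 * normsq mu / n%:R)%:C%C)%:M.

Lemma Mmu0_adj mu : adjmx (Mmu0 mu) = Mmu0 mu.
Proof.
apply/matrixP => i j; have : (Mmu mu j i)^*%R = Mmu mu i j by rewrite -adjmxE Mmu_adj.
rewrite adjmxE /Mmu0; move: (Mmu mu) (_ * _) => M c h; rewrite !mxE rmorphB /= h.
congr (_ - _); rewrite rmorphMn /= eq_sym.
by congr (_ *+ _); rewrite -[LHS]/(conjc _) conjc_real.
Qed.

Lemma mxtrace_sub_scalar (M : 'M[C]_n) (c : C) :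
  \tr ((M - c%:M) *m (M - c%:M)) = \tr (M *m M) - 2 * c * \tr M + c ^+ 2 * n%:R.
Proof.
rewrite mulmxBl !mulmxBr !mul_mx_scalar !mul_scalar_mx scale_scalar_mx.
by rewrite !(raddfB (@mxtrace C n)) /= !mxtraceZ mxtrace_scalar -mulr_natr; ring.
Qed.

Lemma FnE mu : (0 < n)%N -> mu <> (fun _ _ => 0) ->
  Fn mu = 4%:R / n%:R + complex.Re (\tr (Mmu0 mu *m Mmu0 mu)) / normsq mu ^+ 2.
Proof.
move=> n0 /normsq_gt0 mu0; rewrite /Fn.
have nn : n%:R != 0 :> R by rewrite pnatr_eq0 -lt0n.
(* The scalar part contributes (tr M)^2 / n, which is 4 |mu|^4 / n. *)
have -> : \tr (Mmu mu *m Mmu mu) =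
  \tr (Mmu0 mu *m Mmu0 mu) + ((4 * normsq mu ^+ 2 / n%:R)%:C)%C.
  rewrite /Mmu0 mxtrace_sub_scalar mxtrace_Mmu.
  have nE : n%:R = (n%:R : R)%:C%C :> C by rewrite rmorph_nat.
  have twoE : 2 = (2 : R)%:C%C :> C by rewrite rmorph_nat.
  rewrite nE twoE.
  rewrite -rmorphXn -!rmorphM /= -!addrA -[LHS]addr0; congr (_ + _).
  rewrite -!rmorphN -!rmorphD /= -[0]/(0%:C)%C; congr (_%:C)%C.
  by field.
rewrite raddfD /= mulrDl addrC; congr (_ + _).
by field; rewrite nn gt_eqF.
Qed.

Lemma Mmu0_ge0 mu : 0 <= complex.Re (\tr (Mmu0 mu *m Mmu0 mu)).
Proof.
rewrite herm_tr_sq ?Mmu0_adj //.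
by have := hsq_ge0 (Mmu0 mu); rewrite lecE => /andP[_].
Qed.

Lemma Fn_ge mu : (0 < n)%N -> mu <> (fun _ _ => 0) -> 4%:R / n%:R <= Fn mu.
Proof. by move=> n0 mu0; rewrite FnE // lerDl divr_ge0 ?Mmu0_ge0 ?sqr_ge0. Qed.

(** The equality case: the trace-free part has Hilbert-Schmidt norm zero, hence vanishes. *)
Lemma Fn_min_scalar mu : (0 < n)%N -> mu <> (fun _ _ => 0) ->
  Fn mu = 4%:R / n%:R -> Mmu mu = ((- 2 * normsq mu / n%:R)%:C%C)%:M.
Proof.
move=> n0 mu0; rewrite FnE // -[RHS]addr0 => /addrI/eqP.
rewrite mulf_eq0 invr_eq0 sqrf_eq0 [normsq mu == 0]gt_eqF ?normsq_gt0 // orbF.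
rewrite herm_tr_sq ?Mmu0_adj // => /eqP re0.
apply/eqP; rewrite -subr_eq0; apply/eqP/(hsq_eq0 (A := Mmu0 mu)).
by rewrite [LHS]complexE re0 (ger0_Im (hsq_ge0 _)) /= mulr0 addr0.
Qed.

(** Comparing traces gives c n = -2 |mu|^2. So [mu] is nonzero, and the scalar is the one subtracted
    in [Mmu0]. *)
Lemma Fn_scalar mu (c : R) : (0 < n)%N -> c != 0 -> Mmu mu = (c%:C%C)%:M ->
  mu <> (fun _ _ => 0) /\ Fn mu = 4%:R / n%:R.
Proof.
move=> n0 c0 Mc.
have nn : n%:R != 0 :> R by rewrite pnatr_eq0 -lt0n.
have tr := mxtrace_Mmu mu; rewrite Mc mxtrace_scalar in tr.
have {tr} cE : c *+ n = - 2 * normsq mu by apply: complexI; rewrite rmorphMn.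
have mu0 : mu <> (fun _ _ => 0).
  move=> mu0; have : normsq mu = 0.
    rewrite mu0 /normsq.
    by do 3![apply: big1 => ? _]; rewrite mxE /= expr0n addr0.
  move=> ns; move: cE; rewrite ns mulr0 => /eqP; rewrite mulrn_eq0 (negPf c0).
  by rewrite orbF -leqn0 leqNgt n0.
split=> //; rewrite FnE //.
suff -> : Mmu0 mu = 0 by rewrite mul0mx mxtrace0 mul0r addr0.
by rewrite /Mmu0 Mc -cE -[c *+ n]mulr_natr mulfK // subrr.
Qed.

End Bilinear.

(** * Square-zero ideals when the moment matrix is scalar *)

Section SquareZero.
Variables (R : realType) (n : nat).
Local Notation C := R[i].
Local Notation vec := 'cV[C]_n.
Implicit Types (mu : bilin R n) (X Y Z : vec).

Lemma Lmx_mul mu X Y : Lmx mu X *m Y = bapp mu X Y.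
Proof.
rewrite [in RHS](cV_ebasis Y) bapp_sumr; apply/colP => k.
rewrite mxE summxE; apply: eq_bigr => j _.
by rewrite mxE bappZr mxE mulrC.
Qed.

Lemma Rmx_mul mu X Y : Rmx mu X *m Y = bapp mu Y X.
Proof.
rewrite [in RHS](cV_ebasis Y) bapp_suml; apply/colP => k.
rewrite mxE summxE; apply: eq_bigr => j _.
by rewrite mxE bappZl mxE mulrC.
Qed.

Lemma eq_mulmx_cV (A B : 'M[C]_n) : (forall x : vec, A *m x = B *m x) -> A = B.
Proof.
move=> AB; apply/matrixP => i j; have /colP/(_ i) := AB (ebasis R j).
by rewrite -!colE !mxE.
Qed.

(** With [P] the projection onto the ideal, tr(M P) = c |P|^2 is nonpositive, while
    [moment_trace_ge0] makes it nonnegative; so P = 0. *)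
Lemma scalar_square_zero_ideal mu (c : R) (I : vec -> Prop) :
  Mmu mu = (c%:C%C)%:M -> c < 0 -> is_ideal mu I ->
  (forall x y, I x -> I y -> bapp mu x y = 0) -> forall x, I x -> x = 0.
Proof.
move=> Mc c0 [I0 [ID [IZ IM]]] II.
have [P [hP IP PI]] := hproj_exists I0 ID IZ.
have [PP PH] := hP; have hQ := hprojC hP; set Q := 1%:M - P in hQ.
suff P0 : P = 0 by move=> x /PI <-; rewrite P0 mul0mx.
apply: hsq_eq0; rewrite hproj_hsq //.
have PLP i : P *m Lmx mu (ebasis R i) *m P = Lmx mu (ebasis R i) *m P.
  apply: eq_mulmx_cV => x; rewrite -!mulmxA Lmx_mul PI //.
  by have [] := IM (P *m x) (ebasis R i) (IP x).
(* Here the square-zero hypothesis enters: mu(P x, P e_j) = 0, so on the ideal [e_j] may be replaced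
   by [Q e_j]. *)
have PRP j : P *m Rmx mu (Q *m ebasis R j) *m P = Rmx mu (ebasis R j) *m P.
  apply: eq_mulmx_cV => x; rewrite -!mulmxA !Rmx_mul mulmxBl mul1mx bappBr.
  by rewrite (II _ (P *m _)) // subr0 PI //; have [] := IM (P *m x) (ebasis R j) (IP x).
have : 0 <= \tr (Mmu mu *m P).
  (* Both entries are the k-th coordinate of P mu(e_i, Q e_j). *)
  apply: (moment_trace_ge0 hP PLP PRP) => i j k.
  have entry (A : 'M[C]_n) a b : A a b = (A *m ebasis R b) a 0.
    by rewrite -colE mxE.
  by rewrite [LHS]entry [RHS]entry -!mulmxA Lmx_mul Rmx_mul.
rewrite Mc mul_scalar_mx mxtraceZ -hproj_hsq // nmulr_rge0; last first.
  by rewrite -[0]/((0 : R)%:C%C) ltcR.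
by move=> le0; apply/eqP; rewrite eq_le le0 hsq_ge0.
Qed.

End SquareZero.

(** * Primitive idempotents and matrix units in a semiprime algebra *)

Section Semiprime.
Variables (F : closedFieldType) (V : vectType F) (mul : V -> 'End(V)).
Local Notation "x ** y" := (mul x y) (at level 40, left associativity).
Hypothesis mulvDl : forall x y z, (x + y) ** z = x ** z + y ** z.
Hypothesis mulvZl : forall a x z, (a *: x) ** z = a *: (x ** z).
Hypothesis mulvA : forall x y z, x ** y ** z = x ** (y ** z).
Hypothesis semiprime : forall x, (forall a, x ** a ** x = 0) -> x = 0.
Implicit Types (U I J : {vspace V}).

Let mul0v x : 0 ** x = 0.
Proof. by rewrite -[X in X ** _](scale0r x) mulvZl scale0r. Qed.
Let mulvBl x y z : (x - y) ** z = x ** z - y ** z.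
Proof. by rewrite -scaleN1r mulvDl mulvZl scaleN1r. Qed.
Let mulv0 x : x ** 0 = 0.
Proof. exact: linear0. Qed.
Let mulvBr x y z : x ** (y - z) = x ** y - x ** z.
Proof. exact: linearB. Qed.
Let mulvZr a x z : x ** (a *: z) = a *: (x ** z).
Proof. exact: linearZ. Qed.
Let mul_suml (I : finType) (f : I -> V) z :
  (\sum_i f i) ** z = \sum_i f i ** z.
Proof. by elim/big_rec2: _ => [|i a b _ <-]; rewrite ?mul0v ?mulvDl. Qed.

Lemma eigenvector_in (f : 'End(V)) U :
  (forall x, x \in U -> f x \in U) -> U != 0%VS ->
  exists a w, [/\ w \in U, w != 0 & f w = a *: w].
Proof.
move=> fU U0; set d := \dim U; pose X := vbasis U.
have XU i : X`_i \in U.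
  have [lt|ge] := ltnP i d; last by rewrite nth_default ?mem0v // size_tuple.
  by rewrite vbasis_mem // mem_nth // size_tuple.
(* Eigenvectors are row vectors here, so row i holds the coordinates of the image of the i-th basis
   vector. *)
pose A := \matrix_(i < d, j < d) coord X j (f X`_i).
have [a /eigenvalueP[v vA v0]] : exists a, eigenvalue A a.
  have /closed_rootP [a rAa] : size (char_poly A) != 1%N.
    by rewrite size_char_poly eqSS dimv_eq0.
  by exists a; rewrite eigenvalue_root_char.
exists a, (\sum_i v 0 i *: X`_i); split.
- by apply: memv_suml => i _; apply: memvZ.
- apply: contraNneq v0 => v0; apply/eqP/rowP => i; rewrite mxE.
  by have /freeP := basis_free (vbasisP U); apply.
rewrite linear_sum /=.
under eq_bigr => i _ do
  rewrite linearZ /= (coord_vbasis (fU _ (XU i))) scaler_sumr.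
rewrite exchange_big scaler_sumr; apply: eq_bigr => j _ /=.
move/rowP/(_ j): vA; rewrite !mxE scalerA => <-; rewrite scaler_suml.
by apply: eq_bigr => i _; rewrite scalerA mxE.
Qed.

Definition rideal U := forall x a, x \in U -> x ** a \in U.

(** Strong induction on the dimension: a right ideal that is not minimal contains a smaller nonzero
    one. *)
Lemma min_rideal U : rideal U -> U != 0%VS ->
  exists I, [/\ rideal I, (I <= U)%VS, I != 0%VS &
    forall J, rideal J -> (J <= I)%VS -> J != 0%VS -> J = I].
Proof.
have [d] := ubnP (\dim U); elim: d U => // d IHd U ltUd rU U0.
have [minU|] := pselect (forall J, rideal J -> (J <= U)%VS -> J != 0%VS -> J = U).
  by exists U.
move=> /existsNP[J] /not_implyP[rJ] /not_implyP[JU] /not_implyP[J0 neJU].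
have [|I [rI IJ I0 minI]] := IHd J _ rJ J0; last first.
  by exists I; split=> //; apply: subv_trans JU.
rewrite -ltnS; apply: leq_trans ltUd; rewrite ltnS ltn_neqAle dimvS // andbT.
by apply/eqP => dJU; apply: neJU; apply/eqP; rewrite eqEdim JU dJU /=.
Qed.

(** A primitive idempotent, stated by its corner e V e being the line through e, as befits a closed
    field. *)
Definition prim e := [/\ e != 0, e ** e = e & forall a, exists c, e ** a ** e = c *: e].

(** Brauer's lemma finds an idempotent in a minimal right ideal [I]; Schur's lemma over a closed
    field makes it primitive. *)
Lemma prim_exists U : rideal U -> U != 0%VS -> exists2 e, e \in U & prim e.
Proof.
move=> rU U0; have [I [rI /subvP IU I0 minI]] := min_rideal rU U0.
have minI0 (J : {vspace V}) x : rideal J -> (J <= I)%VS -> x \in J -> x != 0 -> J = I.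
  move=> rJ JI xJ x0; apply: minI => //; apply: contraNneq x0 => J0.
  by rewrite -memv0 -J0.
have xI := memv_pick I; set x := vpick I in xI.
have x0 : x != 0 by rewrite vpick0.
have [a xax0] : exists a, x ** a ** x <> 0.
  by apply/existsNP => h; move/eqP: x0; apply; apply: semiprime.
set y := x ** a in xax0; have yI : y \in I by apply: rI.
have rimg z : rideal (mul z @: I)%VS.
  by move=> _ b /memv_imgP[w wI ->]; rewrite mulvA memv_img // rI.
have simg z : z \in I -> (mul z @: I <= I)%VS.
  by move=> zI; apply/subvP => _ /memv_imgP[w wI ->]; apply: rI.
(* The right ideal y I is nonzero, for it contains y x = x a x. *)
have yII : (mul y @: I)%VS = I.
  by apply: (minI0 _ (y ** x)); rewrite ?simg ?memv_img //; apply/eqP.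
have [e eI ye] : exists2 e, e \in I & y = y ** e.
  by move: yI; rewrite -{1}yII => /memv_imgP.
have y0 : y != 0 by apply: contra_notN xax0 => /eqP->.
have e0 : e != 0 by apply: contraNneq y0 => e0; rewrite ye e0 mulv0.
have ee : e ** e = e.
  apply/eqP; rewrite -subr_eq0; apply: contra_notT xax0 => ee0.
  (* If e e - e were nonzero, the annihilator of [y] in [I] would be all of [I], and y x would
     vanish. *)
  have kI : (I :&: lker (mul y))%VS = I.
    apply: (minI0 _ (e ** e - e)) => //.
    - move=> z b; rewrite !memv_cap !memv_ker => /andP[zI /eqP yz].
      by rewrite rI // -mulvA yz mul0v eqxx.
    - exact: capvSl.
    rewrite memv_cap memv_ker rpredB ?rI //=.
    by rewrite mulvBr -mulvA -!ye subrr.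
  by move: xI; rewrite -kI memv_cap memv_ker => /andP[_ /eqP].
exists e; [exact: IU|split=> // a'].
(* Schur: the eigenspace of left multiplication by e a' e in [I] is a nonzero right ideal, hence
   [I]; evaluating at [e] gives e a' e = c e. *)
have [c [w [wI w0 zw]]] : exists c w, [/\ w \in I, w != 0 & mul (e ** a' ** e) w = c *: w].
  by apply: eigenvector_in => // b bI; rewrite !rI.
exists c; set z := e ** a' ** e in zw *.
have kI : (I :&: lker (mul z - c *: \1)%VF)%VS = I.
  apply: (minI0 _ w) => //.
  - move=> t b; rewrite !memv_cap !memv_ker !lfun_simp => /andP[tI /eqP zt].
    rewrite rI //= -mulvA; move/eqP: zt; rewrite subr_eq0 => /eqP->.
    by rewrite mulvZl subrr eqxx.
  - exact: capvSl.
  by rewrite memv_cap memv_ker wI !lfun_simp zw subrr eqxx.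
move: eI; rewrite -kI memv_cap memv_ker !lfun_simp => /andP[_].
by rewrite subr_eq0 => /eqP <-; rewrite /z (mulvA _ e e) ee.
Qed.

(* Matrix units u_k v_l, indexed by the pairs with e_k = e_l; a class of equal
   e_k's is one simple factor. *)
Definition munits (K : finType) (u v e : K -> V) :=
  [/\ forall k, prim (e k), forall k, u k ** e k = u k, forall k, e k ** v k = v k,
      forall k l, v k ** u l = if k == l then e k else 0 &
      forall k l, e k = e l \/ forall a, e k ** a ** e l = 0].

Lemma prim_corner_sym e f : (forall a, e ** a ** f = 0) -> forall a, f ** a ** e = 0.
Proof.
move=> ef a; apply: semiprime => b.
have -> : f ** a ** e ** b ** (f ** a ** e) = f ** a ** (e ** b ** f) ** (a ** e).
  by rewrite !mulvA.
by rewrite ef mulv0 mul0v.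
Qed.

(** A Gram-Schmidt correction: subtracting v' (sum of u_k v_k) makes the new [v] kill every old
    [u_l], and leaves its product with [w] unchanged since every v_k w = 0. *)
Lemma munits_extend (K : finType) (u v e : K -> V) e' w v' :
  munits u v e -> prim e' -> w ** e' = w -> e' ** v' = v' -> v' ** w = e' ->
  (forall k, v k ** w = 0) ->
  (forall k, e' = e k \/ forall a, e' ** a ** e k = 0) ->
  exists v'', munits (fun k : option K => oapp u w k) (fun k => oapp v v'' k)
    (fun k => oapp e e' k).
Proof.
move=> [pe ue ev vu ee] pe' we ev' vw vk0 e'e.
exists (v' - v' ** (\sum_k u k ** v k)); split=> /=.
- by case.
- by case.
- by case=> //=; rewrite mulvBr -mulvA ev'.
- case=> [k|] [l|] //=.
    rewrite mulvBl mulvA mul_suml (bigD1 l) //= big1 => [|i /negPf il].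
      by rewrite addr0 mulvA vu eqxx ue subrr.
    by rewrite mulvA vu il mulv0.
  rewrite mulvBl mulvA mul_suml big1 ?mulv0 ?subr0 // => i _.
  by rewrite mulvA vk0 mulv0.
case=> [k|] [l|] //=; [|by left].
by case: (e'e k) => [->|/prim_corner_sym]; [left|right].
Qed.

(** Enlarge the family while the right ideal [D] of common zeros of the [v_k] is nonzero; each new
    index lowers its dimension. *)
Lemma munits_exist : exists (K : finType) (u v e : K -> V),
  munits u v e /\ forall x, (forall k, v k ** x = 0) -> x = 0.
Proof.
suff : forall d (K : finType) (u v e : K -> V), munits u v e ->
    (\dim (\bigcap_k lker (mul (v k)))%VS < d)%N ->
    exists (K : finType) (u v e : K -> V),
    munits u v e /\ forall x, (forall k, v k ** x = 0) -> x = 0.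
  (* The process starts from the empty family. *)
  by move=> h; apply: (h _ void (fun=> 0) (fun=> 0) (fun=> 0)) (ltnSn _); split; case.
elim=> // d IHd K u v e mue.
set D := (\bigcap_k _)%VS => ltD.
have DP x : (x \in D) = [forall k, v k ** x == 0].
  rewrite memvE; apply/subv_bigcapP/forallP => h k.
    by rewrite -memv_ker memvE h.
  by move=> _; rewrite -memvE memv_ker.
have [D0|D0] := eqVneq D 0%VS.
  exists K, u, v, e; split=> // x vx; apply/eqP; rewrite -memv0 -D0 DP.
  by apply/forallP => k; rewrite vx.
have [pe ue ev vu ee] := mue.
have [|f fD pf] := prim_exists _ D0.
  move=> x a; rewrite !DP => /forallP vx; apply/forallP => k.
  by rewrite -mulvA (eqP (vx k)) mul0v.
suff [e' [w [v' [pe' we ev' vw]]]] : exists e' w v', [/\ prim e', w ** e' = w,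
    e' ** v' = v', v' ** w = e' & w \in D /\
    forall k, e' = e k \/ forall a, e' ** a ** e k = 0].
  move=> [wD e'e].
  have vk0 k : v k ** w = 0 by move: wD; rewrite DP => /forallP/(_ k)/eqP.
  have [v'' m''] := munits_extend mue pe' we ev' vw vk0 e'e.
  apply: IHd (m'') _; apply: leq_trans (ltD : (\dim D <= d)%N); set D' := (\bigcap_k _)%VS.
  have D'P x : x \in D' -> forall k, oapp v v'' k ** x = 0.
    rewrite memvE => /subv_bigcapP h k; apply/eqP.
    by rewrite -memv_ker memvE h.
  have D'D : (D' <= D)%VS.
    apply/subvP => x /D'P h; rewrite DP; apply/forallP => k.
    by rewrite (h (Some k)).
  (* The drop is strict: [w] lies in [D], but the new [v] sends it to e', which is nonzero. *)
  rewrite ltn_neqAle dimvS // andbT; apply/negP => dD.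
  have DD' : D' = D by apply/eqP; rewrite eqEdim D'D (eqP dD) /=.
  have [_ _ _ /(_ None None)/= vw'' _] := m''.
  move: wD; rewrite -DD' => /D'P/(_ None)/=; rewrite vw'' => /eqP.
  by case: pe' => /negPf->.
have vf k : v k ** f = 0 by move: fD; rewrite DP => /forallP/(_ k)/eqP.
(* If [f] is orthogonal to all the [e_k], it opens a new simple factor; otherwise a nonzero f a e_l
   supplies a further [u] for the factor of [e_l]. *)
have [inq|] := pselect (forall k a, f ** a ** e k = 0).
  exists f, f, f; have [_ ff _] := pf; split=> //; split=> // k.
  by right.
move=> /existsNP[l] /existsNP[a].
set w := f ** a ** e l => /eqP w0.
have [e0 el _] := pe l; have [_ ff _] := pf.
have [b wbw] : exists b, w ** b ** w <> 0.
  by apply/existsNP => h; move/eqP: w0; apply; apply: semiprime.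
have wel : w ** e l = w by rewrite /w mulvA el.
have fw : f ** w = w by rewrite /w -!mulvA ff.
have [c ebw] : exists c, e l ** b ** w = c *: e l.
  have [_ _ /(_ (b ** (f ** a)))[c h]] := pe l; exists c.
  by rewrite -h /w !mulvA.
(* Since w e_l = w, c = 0 would give w b w = 0. Rescaling e_l b by the inverse of c then makes its
   product with [w] equal to [e_l]. *)
clearbody w; have c0 : c != 0.
  apply: contra_notN wbw => /eqP c0; move: ebw; rewrite c0 scale0r => ebw.
  have <- : w ** (e l ** b ** w) = w ** b ** w.
    by rewrite !mulvA -(mulvA w (e l)) wel.
  by rewrite ebw mulv0.
exists (e l), w, (c^-1 *: (e l ** b)); split=> //.
- by rewrite mulvZr -mulvA el.
- by rewrite mulvZl ebw scalerA mulVf // scale1r.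
split=> //; rewrite DP; apply/forallP => k.
by rewrite -fw -mulvA vf mul0v.
Qed.

(** * The matrix units form a basis *)

Section Basis.
Variables (K : finType) (u v e : K -> V).
Hypothesis uve : munits u v e.
Hypothesis v_faithful : forall x, (forall k, v k ** x = 0) -> x = 0.

Lemma munits_mul k l p q : e k = e l ->
  (u k ** v l) ** (u p ** v q) = if l == p then u k ** v q else 0.
Proof.
have [_ ue _ vu _] := uve => ekl.
rewrite mulvA -(mulvA (v l)) vu; case: eqP => _; last by rewrite mul0v mulv0.
by rewrite -mulvA -ekl ue.
Qed.

(** Multiplying by [v_k] on the left and [u_l] on the right leaves only the term c_kl e_l. *)
Lemma munits_indep (c : K -> K -> F) :
  \sum_k \sum_(l | e k == e l) c k l *: (u k ** v l) = 0 ->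
  forall k l, e k = e l -> c k l = 0.
Proof.
have [pe ue ev vu ee] := uve => sum0 k l ekl.
have /(congr1 (fun x => v k ** x ** u l)) := sum0.
rewrite mulv0 mul0v linear_sum mul_suml (bigD1 k) //= [X in _ + X]big1 => [|i ik]; last first.
  rewrite linear_sum big1 ?mul0v // => j _.
  by rewrite linearZ /= -mulvA vu eq_sym (negPf ik) mul0v scaler0 .
rewrite linear_sum.
have -> : \sum_(i | e k == e i) v k ** (c k i *: (u k ** v i)) =
    \sum_i (if e k == e i then c k i *: (e k ** v i) else 0).
  rewrite -big_mkcond; apply: eq_bigr => i _.
  by rewrite linearZ /= -mulvA vu eqxx.
rewrite addr0 mul_suml (bigD1 l) //= big1 => [|i /negPf il]; last first.
  by case: eqP => _; rewrite ?mul0v // mulvZl mulvA vu il mulv0 scaler0.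
rewrite ekl eqxx mulvZl mulvA vu eqxx addr0.
have [e0 eel _] := pe l; rewrite eel => /eqP.
by rewrite scaler_eq0 (negPf e0) orbF => /eqP.
Qed.

(** The sum [f] of the u_k v_k is a unit, so x = f x f is the sum of the u_k (v_k x u_l) v_l. The
    middle factor lies in e_k V e_l, which is the line through [e_k] or zero. *)
Lemma munits_span x : exists c : K -> K -> F,
  x = \sum_k \sum_(l | e k == e l) c k l *: (u k ** v l).
Proof.
have [pe ue ev vu ee] := uve.
pose f := \sum_k u k ** v k.
have f1 y : f ** y = y.
  apply/eqP; rewrite -subr_eq0; apply/eqP/v_faithful => k.
  rewrite mulvBr -mulvA /f linear_sum mul_suml (bigD1 k) //= big1 => [|i ik].
    by rewrite -mulvA vu eqxx ev addr0 subrr.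
  by rewrite -mulvA vu eq_sym (negPf ik) !mul0v.
(* As [f] is a left unit, b f = 0 gives b z b = b f z b = 0 for all z, and semiprimeness yields b =
   0. *)
have f2 y : y ** f = y.
  apply/eqP; rewrite eq_sym -subr_eq0; apply/eqP; set b := y - _.
  have bf : b ** f = 0 by rewrite /b mulvBl mulvA f1 subrr.
  by apply: semiprime => z; rewrite -(f1 z) -mulvA bf !mul0v.
have cP k l : exists c, e k = e l -> v k ** x ** u l = c *: e k.
  have [ekl|] := eqVneq (e k) (e l); last by move=> ne; exists 0 => /eqP; rewrite (negPf ne).
  have [_ _ /(_ (v k ** x ** u l))[c h]] := pe k; exists c => _.
  by rewrite -h mulvA ekl !mulvA ue -!mulvA -ekl ev.
have /choice[c hc] : forall kl : K * K, exists c, e kl.1 = e kl.2 ->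
    v kl.1 ** x ** u kl.2 = c *: e kl.1 by move=> [k l]; apply: cP.
exists (fun k l => c (k, l)).
rewrite -[LHS]f2 -(f1 x) /f mulvA mul_suml; apply: eq_bigr => k _.
rewrite linear_sum /= linear_sum [RHS]big_mkcond; apply: eq_bigr => l _ /=.
rewrite mulvA -(mulvA x) -(mulvA (v k)) -(mulvA (v k) x); case: eqP => [ekl|ne].
  by rewrite (hc (k, l)) //= mulvZl mulvZr ekl ev.
case: (ee k l) => // ekl.
have -> : v k ** x ** u l = e k ** (v k ** x ** u l) ** e l.
  by rewrite !mulvA ue -(mulvA (e k)) ev.
by rewrite ekl mul0v mulv0.
Qed.

End Basis.
End Semiprime.

(** * Structure constants of rescaled matrix units *)

Section Groupoid.
Variables (F : fieldType) (n : nat) (K : finType) (r : rel K) (t : K -> F).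
Variable tau : 'I_n -> K * K.
Hypothesis r_equiv : equivalence_rel r.
Hypothesis tau_inj : injective tau.
Hypothesis tauP : forall p, r p.1 p.2 <-> exists i, tau i = p.
Hypothesis t_r : forall k l, r k l -> t k = t l.
Hypothesis t2 : forall k, t k * t k *+ #|r k| = 1.

(** The i-th basis vector is seen as an arrow with source and target [tau i]. Composable arrows
    (k,l) and (l,m) multiply to [t k] times (k,m), as matrix units scaled by [t] do. The k-th
    argument picks the coefficient. *)
Definition groupoid_coef i j k : F :=
  if ((tau i).2 == (tau j).1) && (tau k == ((tau i).1, (tau j).2))
  then t (tau i).1 else 0.

Let r_refl k : r k k. Proof. by have [] := r_equiv k k k. Qed.
Let r_sym k l : r k l = r l k.
Proof.
suff h x y : r x y -> r y x by apply/idP/idP => /h.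
by move=> xy; have [_ /(_ xy)] := r_equiv x y x; rewrite r_refl => <-.
Qed.
Let r_trans k l m : r k l -> r l m -> r k m.
Proof. by move=> kl lm; have [_ ->] := r_equiv k l m. Qed.
Let r_tau i : r (tau i).1 (tau i).2. Proof. by apply/tauP; exists i. Qed.

Let sum_at p c : r p.1 p.2 -> \sum_k (if tau k == p then c else 0) = c :> F.
Proof.
move=> /tauP[k <-]; rewrite (bigD1 k) //= eqxx big1 ?addr0 // => j /negPf jk.
by rewrite (inj_eq tau_inj) jk.
Qed.

Let sum_src p c : \sum_i (if (tau i).1 == p then c else 0) = c *+ #|r p| :> F.
Proof.
rewrite -big_mkcond sumr_const; congr (_ *+ _).
rewrite -[RHS](_ : #|[set (tau i).2 | i in [pred i | (tau i).1 == p]]| = _).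
  rewrite card_in_imset // => i j /eqP ip /eqP jp ij; apply: tau_inj.
  by rewrite [tau i]surjective_pairing [tau j]surjective_pairing ip jp ij.
apply: eq_card => l; apply/imsetP/idP => [[i /eqP ip ->]|rpl].
  by rewrite -ip; apply: r_tau.
have /tauP[i ti] : r (p, l).1 (p, l).2 by [].
by exists i; rewrite ?inE ti.
Qed.

Let sum_tgt p c : \sum_i (if (tau i).2 == p then c else 0) = c *+ #|r p| :> F.
Proof.
rewrite -big_mkcond sumr_const; congr (_ *+ _).
rewrite -[RHS](_ : #|[set (tau i).1 | i in [pred i | (tau i).2 == p]]| = _).
  rewrite card_in_imset // => i j /eqP ip /eqP jp ij; apply: tau_inj.
  by rewrite [tau i]surjective_pairing [tau j]surjective_pairing ip jp ij.
apply: eq_card => l; apply/imsetP/idP => [[i /eqP ip ->]|rpl].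
  by rewrite -ip -topredE /= r_sym; apply: r_tau.
have /tauP[i ti] : r (l, p).1 (l, p).2 by rewrite /= r_sym.
by exists i; rewrite ?inE ti.
Qed.

(** An arrow from k factors through each point of its class once, so the diagonal sum is [t k]
    squared times the class size, which is 1. Two factors determine their product, so the other sums
    vanish. *)
Lemma groupoid_sum_out a b :
  \sum_i \sum_j groupoid_coef i j a * groupoid_coef i j b = (a == b)%:R.
Proof.
have [<-|ab] := eqVneq a b; last first.
  apply: big1 => i _; apply: big1 => j _; rewrite /groupoid_coef.
  case: ifP => [/andP[_ /eqP ta]|]; last by rewrite mul0r.
  case: ifP => [/andP[_ /eqP tb]|]; last by rewrite mulr0.
  by case/eqP: ab; apply: tau_inj; rewrite ta tb.
rewrite -(t2 (tau a).1) -sum_src; apply: eq_bigr => i _.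
case: eqP => [ia|ia]; last first.
  apply: big1 => j _; rewrite /groupoid_coef.
  by case: ifP => [/andP[_ /eqP ta]|]; [rewrite ta in ia|rewrite mul0r].
rewrite -[RHS](@sum_at ((tau i).2, (tau a).2)) /=; last first.
  by apply: r_trans (r_tau a); rewrite r_sym -ia.
apply: eq_bigr => j _; rewrite /groupoid_coef.
rewrite [tau a]surjective_pairing [tau j in RHS]surjective_pairing !xpair_eqE.
rewrite /= ia eqxx /= eq_sym [(tau a).2 == _]eq_sym.
by case: ifP; rewrite ?mul0r.
Qed.

(** The same count over the left factors of a fixed arrow [a]: one for each point of the class of
    its source. The left factor and the product determine [a]. *)
Lemma groupoid_sum_right a b :
  \sum_i \sum_k groupoid_coef i a k * groupoid_coef i b k = (a == b)%:R.
Proof.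
have [<-|ab] := eqVneq a b; last first.
  apply: big1 => i _; apply: big1 => j _; rewrite /groupoid_coef.
  case: ifP => [/andP[/eqP ia /eqP ta]|]; last by rewrite mul0r.
  case: ifP => [/andP[/eqP ib /eqP tb]|]; last by rewrite mulr0.
  case/eqP: ab; apply: tau_inj; move: tb; rewrite ta => -[h].
  by rewrite [tau a]surjective_pairing [tau b]surjective_pairing -ia ib h.
rewrite -(t2 (tau a).1) -sum_tgt; apply: eq_bigr => i _.
case: eqP => [ia|/eqP/negPf ia]; last first.
  by apply: big1 => j _; rewrite /groupoid_coef ia mul0r.
have tia : t (tau i).1 = t (tau a).1 by apply: t_r; rewrite -ia r_tau.
rewrite -[RHS](@sum_at ((tau i).1, (tau a).2)) /=; last first.
  by apply: r_trans (r_tau a); rewrite -ia r_tau.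
apply: eq_bigr => j _; rewrite /groupoid_coef ia eqxx tia /=.
by case: ifP; rewrite ?mul0r.
Qed.

Lemma groupoid_sum_left a b :
  \sum_i \sum_k groupoid_coef a i k * groupoid_coef b i k = (a == b)%:R.
Proof.
have [<-|ab] := eqVneq a b; last first.
  apply: big1 => i _; apply: big1 => j _; rewrite /groupoid_coef.
  case: ifP => [/andP[/eqP ia /eqP ta]|]; last by rewrite mul0r.
  case: ifP => [/andP[/eqP ib /eqP tb]|]; last by rewrite mulr0.
  case/eqP: ab; apply: tau_inj; move: tb; rewrite ta => -[h].
  by rewrite [tau a]surjective_pairing [tau b]surjective_pairing ia ib h.
rewrite -(t2 (tau a).2) -sum_src; apply: eq_bigr => i _.
rewrite [_ == (tau a).2]eq_sym; case: eqP => [ia|/eqP/negPf ia]; last first.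
  by apply: big1 => j _; rewrite /groupoid_coef ia mul0r.
have tia : t (tau a).1 = t (tau a).2 by apply: t_r; rewrite r_tau.
rewrite -[RHS](@sum_at ((tau a).1, (tau i).2)) /=; last first.
  by apply: r_trans (r_tau a) _; rewrite ia r_tau.
apply: eq_bigr => j _; rewrite /groupoid_coef -tia ia eqxx /=.
by case: ifP; rewrite ?mul0r.
Qed.

End Groupoid.

(** * Semisimplicity and the minimum *)

Section Main.
Variables (R : realType) (n : nat).
Local Notation C := R[i].
Local Notation vec := 'cV[C]_n.
Implicit Types (mu : bilin R n).

(** The coefficients are real, so the three sums in M are the three groupoid sums, each the
    identity. *)
Lemma Mmu_groupoid mu (K : finType) (r : rel K) (t : K -> R) (tau : 'I_n -> K * K) :
  equivalence_rel r -> injective tau ->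
  (forall p, r p.1 p.2 <-> exists i, tau i = p) ->
  (forall k l, r k l -> t k = t l) ->
  (forall k, t k * t k *+ #|r k| = 1) ->
  (forall i j k, mu i j k 0 = groupoid_coef (fun k => (t k)%:C%C) tau i j k) ->
  Mmu mu = ((-2)%:C%C)%:M.
Proof.
move=> req tinj tauP tr t2 muE; set f := groupoid_coef _ _ in muE.
have fJ i j k : (f i j k)^*%R = f i j k.
  rewrite /f /groupoid_coef; case: ifP => _; last by rewrite rmorph0.
  exact: conjc_real.
have tr' k l : r k l -> (t k)%:C%C = (t l)%:C%C by move=> /tr ->.
have t2' k : (t k)%:C%C * (t k)%:C%C *+ #|r k| = 1.
  by rewrite -rmorphM -rmorphMn /= t2.
apply/matrixP => a b; rewrite MmuE.
have S1 : \sum_i \sum_j mu i j a 0 * (mu i j b 0)^*%R = (a == b)%:R.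
  rewrite -(groupoid_sum_out req tinj tauP t2').
  by apply: eq_bigr => i _; apply: eq_bigr => j _; rewrite !muE fJ.
have S2 : \sum_i \sum_k (mu i a k 0)^*%R * mu i b k 0 = (a == b)%:R.
  rewrite -(groupoid_sum_right req tinj tauP tr' t2').
  by apply: eq_bigr => i _; apply: eq_bigr => j _; rewrite !muE fJ.
have S3 : \sum_i \sum_k (mu a i k 0)^*%R * mu b i k 0 = (a == b)%:R.
  rewrite -(groupoid_sum_left req tinj tauP tr' t2').
  by apply: eq_bigr => i _; apply: eq_bigr => j _; rewrite !muE fJ.
rewrite S1 S2 S3.
by rewrite subrr sub0r !mxE rmorphN rmorph_nat mulNrn mulr_natr.
Qed.

Lemma semisimple_semiprime mu : assoc mu -> semisimple mu ->
  forall x, (forall a, bapp mu (bapp mu x a) x = 0) -> x = 0.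
Proof.
move=> mA ss x xax.
(* The elements satisfying both [T] and [T'] form an ideal containing [x], handier than the ideal
   spanned by products with [x]. *)
pose T z := forall a, bapp mu (bapp mu x a) z = 0.
pose T' z := forall a w, T w -> bapp mu (bapp mu z a) w = 0.
apply: (ss (fun z => T z /\ T' z)).
- split; [|split; [|split]].
  + by split=> [a|a w _]; rewrite ?bapp0r ?bapp0l.
  + move=> y z [Ty Ty'] [Tz Tz']; split=> [a|a w Tw].
      by rewrite bappDr Ty Tz addr0.
    by rewrite !bappDl Ty' // Tz' // addr0.
  + move=> c z [Tz Tz']; split=> [a|a w Tw].
      by rewrite bappZr Tz scaler0.
    by rewrite !bappZl Tz' // scaler0.
  + move=> z y [Tz Tz']; split; split=> [a|a w Tw].
    * by rewrite -mA Tz bapp0l.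
    * by rewrite (mA z) Tz'.
    * by rewrite -mA (mA x) Tz.
    * by rewrite (mA y) mA Tz' // bapp0r.
(* A list of length 2 means a product of three factors: the first satisfies [T'], the last [T]. *)
- exists 2%N => z [|y1 [|y2 []]] //= [_ Tz] ys _.
  by apply: Tz; case: (ys y2); rewrite ?inE ?eqxx ?orbT.
- by split=> // a w; apply.
Qed.

(** Induction on the nilpotency index. The longest products not known to vanish lie in the two-sided
    annihilator of [I] within [I], which is a square-zero ideal. *)
Lemma square_zero_semisimple mu : assoc mu ->
  (forall I, is_ideal mu I -> (forall x y, I x -> I y -> bapp mu x y = 0) ->
     forall x, I x -> x = 0) -> semisimple mu.
Proof.
move=> mA sz I [I0 [ID [IZ IM]]] [k]; elim: k => [nil x Ix|k IHk nil].
  by apply: (nil x [::]).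
apply: IHk => x s Ix sI sk.
have IF y s' : I y -> (forall z, z \in s' -> I z) -> I (foldl (bapp mu) y s').
  elim: s' y => //= z s' IHs y Iy zI; apply: IHs => [|w ws].
    by case: (IM y z).
  by apply: zI; rewrite inE ws orbT.
have foldl_mul y z s' :
    bapp mu y (foldl (bapp mu) z s') = foldl (bapp mu) (bapp mu y z) s'.
  by elim: s' z => //= w s' IHs z; rewrite IHs mA.
apply: (sz (fun x => I x /\ forall y, I y -> bapp mu x y = 0 /\ bapp mu y x = 0)).
- split; [|split; [|split]].
  + by split=> // y _; rewrite bapp0l bapp0r.
  + move=> y z [Iy hy] [Iz hz]; split=> [|w Iw]; first exact: ID.
    have [y1 y2] := hy w Iw; have [z1 z2] := hz w Iw.
    by rewrite bappDl bappDr y1 y2 z1 z2 addr0.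
  + move=> a z [Iz hz]; split=> [|w Iw]; first exact: IZ.
    by have [z1 z2] := hz w Iw; rewrite bappZl bappZr z1 z2 scaler0.
  + move=> y z [Iy hy]; have [Iyz Izy] := IM y z Iy.
    split; split=> // w Iw; have [Iwz Izw] := IM w z Iw.
      by rewrite mA (hy _ Izw).1 -mA (hy _ Iw).2 bapp0l.
    by rewrite mA (hy _ Iw).1 bapp0r -mA (hy _ Iwz).2.
- by move=> y z [Iy hy] [Iz _]; case: (hy z Iz).
split=> [|y Iy]; first exact: IF.
split; last first.
  rewrite foldl_mul; apply: (nil y (x :: s)) => //=; last by rewrite sk.
  by move=> z; rewrite inE => /orP[/eqP->|/sI].
have <- : foldl (bapp mu) x (rcons s y) = bapp mu (foldl (bapp mu) x s) y.
  by rewrite -cats1 foldl_cat.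
apply: nil => //; last by rewrite size_rcons sk.
by move=> z; rewrite mem_rcons inE => /orP[/eqP->|/sI].
Qed.

Lemma semisimple_matrix_units mu : assoc mu -> semisimple mu ->
  exists2 g : 'M[C]_n, g \in unitmx & Mmu (gact g mu) = ((-2)%:C%C)%:M.
Proof.
move=> mA ss.
pose mul (x : vec) : 'End(vec) := linfun (bapp mu x).
have mulE x y : mul x y = bapp mu x y by rewrite lfunE.
have mulDl x y z : mul (x + y) z = mul x z + mul y z by rewrite !mulE bappDl.
have mulZl a x z : mul (a *: x) z = a *: mul x z by rewrite !mulE bappZl.
have mulA x y z : mul (mul x y) z = mul x (mul y z) by rewrite !mulE mA.
have sp x : (forall a, mul (mul x a) x = 0) -> x = 0.
  move=> h; apply: (semisimple_semiprime mA ss) => a.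
  by rewrite -!mulE h.
have [K [u [v [e [uve vf]]]]] := munits_exist mulDl mulZl mulA sp.
have ind := munits_indep mulDl mulZl mulA uve.
have spn := munits_span mulDl mulZl mulA sp uve vf.
have prd := munits_mul mulZl mulA uve.
clearbody mul.
pose r k l := e k == e l.
(* A class of size N is a factor of N by N matrices; the scaling is N^(-1/2). *)
pose t k : R := (Num.sqrt #|r k|%:R)^-1.
have t_r k l : r k l -> t k = t l.
  by move=> /eqP ekl; congr ((Num.sqrt (_%:R))^-1); rewrite /r ekl.
have rk0 k : #|r k| != 0%N by rewrite -lt0n; apply/card_gt0P; exists k; apply/eqP.
have t2 k : t k * t k *+ #|r k| = 1.
  rewrite -invfM -expr2 sqr_sqrtr ?ler0n // -mulr_natr mulVf //.
  by rewrite pnatr_eq0.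
have t0 k : (t k)%:C%C != 0 :> C.
  apply/eqP => /complexI tk; have := t2 k; rewrite tk mul0r mul0rn => /esym/eqP.
  by rewrite oner_eq0.
pose T := {p : K * K | r p.1 p.2}.
pose b (p : K * K) : vec := (t p.1)%:C%C *: mul (u p.1) (v p.2).
have sumT (G : K * K -> vec) :
    \sum_(p : T) G (val p) = \sum_k \sum_(l | e k == e l) G (k, l).
  rewrite pair_big_dep /= -big_sub /=.
  by apply: eq_bigr => -[].
have indT (c : T -> C) : \sum_p c p *: b (val p) = 0 -> forall p, c p = 0.
  (* Extending [c] by zero to all pairs lets the sum over the subtype become a double sum. *)
  pose G q := oapp c 0 (insub q) *: b q.
  have -> : \sum_p c p *: b (val p) = \sum_(p : T) G (val p).
    by apply: eq_bigr => p _; rewrite /G valK.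
  rewrite sumT => sum0 p.
  have /ind/(_ (val p).1 (val p).2 (eqP (valP p)))/eqP : \sum_k \sum_(l | e k == e l)
      (oapp c 0 (insub (k, l)) * (t k)%:C%C) *: mul (u k) (v l) = 0.
    rewrite -[RHS]sum0; apply: eq_bigr => k _; apply: eq_bigr => l _.
    by rewrite /G /b scalerA.
  by rewrite -surjective_pairing valK mulf_eq0 (negPf (t0 _)) orbF => /eqP.
have spnT x : exists c : T -> C, x = \sum_p c p *: b (val p).
  have [c ->] := spn x; exists (fun p => c (val p).1 (val p).2 / (t (val p).1)%:C%C).
  rewrite (sumT (fun p => (c p.1 p.2 / (t p.1)%:C%C) *: b p)).
  apply: eq_bigr => k _; apply: eq_bigr => l _.
  by rewrite /b scalerA divfK.
have reT (G : T -> vec) : \sum_p G p = \sum_(i < #|{: T}|) G (enum_val i).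
  by apply: reindex; apply/onW_bij/enum_val_bij.
(* The rescaled matrix units are free and span the space, so there are n of them. *)
have cardT : n = #|{: T}|.
  pose X := [tuple b (val (enum_val i)) | i < #|{: T}|].
  have XE (i : 'I_#|{: T}|) : X`_i = b (val (enum_val i)).
    by rewrite -tnth_nth tnth_mktuple.
  have freeX : free X.
    apply/freeP => c sum0 i.
    rewrite -(indT (fun p => c (enum_rank p)) _ (enum_val i)) ?enum_valK //.
    by rewrite reT -[RHS]sum0; apply: eq_bigr => j _; rewrite enum_valK XE.
  have spanX : <<X>>%VS = fullv.
    apply/vspaceP => x; rewrite memvf; have [c ->] := spnT x.
    rewrite reT; apply: memv_suml => i _; apply/memvZ/memv_span.
    by rewrite -XE mem_nth // size_tuple.
  by move: freeX; rewrite /free spanX size_tuple dimvf /dim /= muln1 => /eqP.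
pose tau (i : 'I_n) : K * K := val (enum_val (cast_ord cardT i)).
have tau_inj : injective tau.
  by move=> i j /val_inj/enum_val_inj/cast_ord_inj.
have tauP p : r p.1 p.2 <-> exists i, tau i = p.
  split=> [rp|[i <-]]; last exact: (valP (enum_val (cast_ord cardT i))).
  exists (cast_ord (esym cardT) (enum_rank (exist _ p rp : T))).
  by rewrite /tau cast_ordKV enum_rankK.
pose B := \matrix_(i, j) b (tau j) i 0.
have BE j : B *m ebasis R j = b (tau j).
  by rewrite -colE; apply/colP => i; rewrite !mxE.
have /choice[y By] : forall j, exists y, B *m y = ebasis R j.
  move=> j; have [c ->] := spnT (ebasis R j).
  exists (\sum_i c (enum_val (cast_ord cardT i)) *: ebasis R i).
  rewrite reT mulmx_sumr (reindex (cast_ord cardT)) /=; last first.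
    apply/onW_bij; exists (cast_ord (esym cardT)) => i;
      by rewrite ?cast_ordK ?cast_ordKV.
  by apply: eq_bigr => i _; rewrite -scalemxAr BE.
have uB : B \in unitmx.
  have /mulmx1_unit[] // : B *m \matrix_(i, j) y j i 0 = 1%:M.
  apply/matrixP => i j; have /colP/(_ i) := By j; rewrite !mxE eqxx andbT => <-.
  by apply: eq_bigr => k _; rewrite mxE.
(* [invmx B] carries the vectors [b] to the standard basis, so the new structure constants are those
   of [mu] in the basis [b]. *)
exists (invmx B); first by rewrite unitmx_inv.
apply: (@Mmu_groupoid _ K r t tau) => //.
  by move=> x y' z; split=> [|/eqP]; rewrite /r ?eqxx // => ->.
move=> i j k; rewrite /gact invmxK !BE /b bappZl bappZr -!mulE.
rewrite prd; last by apply/eqP; apply/(tauP (tau i)); exists i.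
rewrite /groupoid_coef; case: eqP => [ij|_]; last first.
  by rewrite !scaler0 mulmx0 mxE.
have r_tau l : r (tau l).1 (tau l).2 by apply/tauP; exists l.
have rij : r (tau i).1 (tau j).2 by rewrite /r (eqP (r_tau i)) ij; apply: r_tau.
have [m tm] := (tauP ((tau i).1, (tau j).2)).1 rij.
have -> : (t (tau j).1)%:C%C *: mul (u (tau i).1) (v (tau j).2) = B *m ebasis R m.
  rewrite BE tm /b; congr ((_)%:C%C *: _) => /=; rewrite -ij; apply/esym/t_r.
  exact: r_tau.
rewrite -scalemxAr mulKmx // !mxE -tm (inj_eq tau_inj) eqxx andbT.
by case: eqP => _; rewrite ?mulr1 ?mulr0.
Qed.

Lemma bapp_diag (X Y : vec) k :
  bapp (fun i j : 'I_n => if i == j then ebasis R i else 0) X Y k 0 = X k 0 * Y k 0.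
Proof.
rewrite /bapp summxE (bigD1 k) //= [X in _ + X]big1 => [|i ik].
  rewrite addr0 summxE (bigD1 k) //= big1 => [|j jk].
    by rewrite addr0 eqxx !mxE !eqxx mulr1.
  by rewrite mxE eq_sym (negPf jk) mxE mulr0.
rewrite summxE big1 // => j _; rewrite mxE; case: eqP => _; rewrite mxE ?mulr0 //.
by rewrite eq_sym (negPf ik) mulr0.
Qed.

(** The algebra C^n with componentwise product is the groupoid whose classes are single points, with
    all scalings 1. *)
Lemma min_attained : (0 < n)%N -> exists nu : bilin R n,
  [/\ nu <> (fun _ _ => 0), assoc nu & Fn nu = 4%:R / n%:R].
Proof.
move=> n0; pose nu : bilin R n := fun i j => if i == j then ebasis R i else 0.
have Mnu : Mmu nu = ((-2)%:C%C)%:M.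
  apply: (@Mmu_groupoid _ 'I_n eq_op (fun=> 1) (fun i => (i, i))) => //.
  - by move=> x y z; split=> // /eqP->.
  - by move=> i j [].
  - by move=> [i j] /=; split=> [/eqP->|[k [<- <-]]//]; exists j.
  - by move=> k; rewrite mulr1 (eq_card (B := pred1 k)) ?card1 // => i; rewrite !inE eq_sym.
  move=> i j k; rewrite /nu /groupoid_coef /= xpair_eqE.
  case: eqP => [<-|_]; last by rewrite mxE.
  by rewrite mxE eqxx andbT andbb; case: eqP.
have [|nu0 Fnu] := Fn_scalar n0 _ Mnu; first by rewrite oppr_eq0 pnatr_eq0.
by exists nu; split=> // X Y Z; apply/colP => k; rewrite !bapp_diag mulrA.
Qed.

Lemma gact_ideal g mu (I : vec -> Prop) : g \in unitmx -> is_ideal mu I ->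
  is_ideal (gact g mu) (fun x => I (invmx g *m x)).
Proof.
move=> gu [I0 [ID [IZ IM]]]; split; first by rewrite mulmx0.
split; first by move=> x y Ix Iy; rewrite mulmxDr; apply: ID.
split; first by move=> a x Ix; rewrite -scalemxAr; apply: IZ.
by move=> x y Ix; rewrite !gactE !mulKmx //; apply: IM.
Qed.

End Main.

Unset Implicit Arguments.

Theorem theorem4p6 (R : realType) (n : nat) (mu : bilin R n) :
  (0 < n)%N -> assoc mu ->
  ((exists g : 'M[R[i]]_n, g \in unitmx /\ is_min_point (gact g mu))
     <-> semisimple mu) /\
  (forall g : 'M[R[i]]_n, g \in unitmx -> is_min_point (gact g mu) ->
     Fn (gact g mu) = 4%:R / n%:R).
Proof.
move=> n0 mA.
(* The bound 4/n is attained by some associative algebra, so it is the minimum value. *)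
have minF (nu : bilin R n) : is_min_point nu -> Fn nu = 4%:R / n%:R.
  move=> [nu0 [_ numin]]; apply/eqP; rewrite eq_le Fn_ge // andbT.
  by have [nu' [nu'0 nu'A <-]] := min_attained R n0; apply: numin.
split=> [|g _]; last exact: minF.
split=> [[g [gu gmin]]|ss].
  apply: square_zero_semisimple => // I idI II x Ix.
  have [g0 [gA _]] := gmin.
  have Mg := Fn_min_scalar n0 g0 (minF _ gmin).
  have c0 : - 2 * normsq (gact g mu) / n%:R < 0.
    by rewrite -mulrA mulNr oppr_lt0 !mulr_gt0 ?normsq_gt0 ?invr_gt0 ?ltr0n.
  (* The square-zero ideal is carried by [g] to one of the algebra with scalar moment matrix. *)
  have gx0 : g *m x = 0.
    apply: (scalar_square_zero_ideal Mg c0 (gact_ideal gu idI)).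
      by move=> y z Iy Iz; rewrite gactE II // mulmx0.
    by rewrite mulKmx.
  by rewrite -[x](mulKmx gu) gx0 mulmx0.
have [g gu Mg] := semisimple_matrix_units mA ss.
have [|g0 Fg] := Fn_scalar n0 _ Mg; first by rewrite oppr_eq0 pnatr_eq0.
exists g; split=> //; split=> //; split; first exact: gact_assoc.
by move=> nu nu0 _; rewrite Fg Fn_ge.
Qed.
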